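(* Let $T_{\mathrm{S}}$ be the stopping time of the Successive CuSum (S-CuSum) procedure with thresholds $b_0=b_C=\log\gamma$. As $\gamma\to\infty$, $$\mathrm{WADD}_{f_B}(T_{\mathrm{S}})\;\le\;\left(\frac{\log\gamma}{D_{KL}(f_B\|f_0)}+\frac{\log\gamma}{D_{KL}(f_B\|f_C)}\right)(1+o(1))\;\le\;\frac{2\log\gamma}{\min\{D_{KL}(f_B\|f_0),\,D_{KL}(f_B\|f_C)\}}(1+o(1)),$$ where the $o(1)$ terms tend to $0$ as $\gamma\to\infty$.
   Context: Setting: $X_1, X_2, \dots$ is a sequence of independent random variables observed sequentially. The densities $f_0$ (pre-change), $f_C$ (confusing change), $f_B$ (bad change) are known, pairwise different, and are densities on a common measurable space. For a deterministic change-point $\nu\in\{1,2,\dots\}$, $\mathbb{P}_{\nu,f_B}$ (expectation $\mathbb{E}_{\nu,f_B}$) is the probability measure under which $X_t\sim f_0$ for $t<\nu$ and $X_t\sim f_B$ for $t\ge\nu$, all independent. Delay (Pollak's criterion): $\mathrm{WADD}_{f_B}(T):=\sup_{\nu\ge1}\mathbb{E}_{\nu,f_B}[T-\nu\mid T\ge\nu]$. Kullback–Leibler divergence: $D_{KL}(f\|g):=\mathbb{E}_{f}[\log(f(X)/g(X))]$, where $X\sim f$. S-CuSum procedure with thresholds $b_0,b_C$: write $x^+=\max\{x,0\}$, $W[t]:=\log\frac{f_B(X_t)}{f_0(X_t)}$, $\Lambda[t]:=\log\frac{f_B(X_t)}{f_C(X_t)}$. Define $\mathrm{CuSum}_W[0]=0$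 and, for $t\ge1$, $\mathrm{CuSum}_W[t]=(\mathrm{CuSum}_W[t-1]+W[t])^+$ if $\mathrm{CuSum}_W[t-1]<b_0$, and $\mathrm{CuSum}_W[t]=\mathrm{CuSum}_W[t-1]$ otherwise. Define $\mathrm{CuSum}^{\mathrm{S}}_\Lambda[t]=0$ if $t=0$ or $\mathrm{CuSum}_W[t]<b_0$, and $\mathrm{CuSum}^{\mathrm{S}}_\Lambda[t]=(\mathrm{CuSum}^{\mathrm{S}}_\Lambda[t-1]+\Lambda[t])^+$ otherwise. The stopping time is $T_{\mathrm{S}}:=\inf\{t\ge1:\ \mathrm{CuSum}_W[t]\ge b_0,\ \mathrm{CuSum}^{\mathrm{S}}_\Lambda[t]\ge b_C\}$.
   Formalization: It is assumed in addition that at least one of the divergences D_KL(f_B‖f_0), D_KL(f_B‖f_C) is finite; if both are infinite the bound reads log γ/∞ = 0, which is undefined or false in general since the delay can be positive. *)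

(* Defs.v *)
From HB Require Import structures.
From mathcomp Require Export all_boot all_order all_algebra.
From mathcomp Require Export all_classical all_reals all_analysis.
Set Implicit Arguments.
Unset Strict Implicit.
Unset Printing Implicit Defensive.
Export Order.TTheory GRing.Theory Num.Theory.
Export numFieldNormedType.Exports.

Local Open Scope classical_set_scope.
Local Open Scope ring_scope.
Local Open Scope ereal_scope.

Section densities.
Context (R : realType) (d : measure_display) (E : measurableType d).
Variable mu : {measure set E -> \bar R}.

Definition is_density (f : E -> R) : Prop :=
  [/\ measurable_fun [set: E] f, forall x, (0 <= f x)%R &
      \int[mu]_x (f x)%:E = 1].

(* Different densities means different distributions, i.e. densities that
   do not agree mu-almost everywhere. *)
Definition distinct_densities (f g : E -> R) : Prop :=
  ~ {ae mu, forall x, f x = g x}.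

(* Extended-real valued: it is +oo where f > 0 = g and -oo where f = 0.
   In particular the undetermined case f x = g x = 0 is read as -oo. *)
Definition llr (f g : E -> R) (x : E) : \bar R := lne ((f x)%:E / (g x)%:E).

(* The mean of log (f X / g X) for X of density f with respect to mu; the
   points where f = 0 contribute -oo * 0 = 0. *)
Definition KL (f g : E -> R) : \bar R := \int[mu]_x (llr f g x * (f x)%:E).

End densities.

Section model.
Context (R : realType) (d dO : measure_display) (E : measurableType d)
  (Omega : measurableType dO).
Implicit Types (P : probability Omega R) (X : nat -> Omega -> E).

Definition has_density (mu : {measure set E -> \bar R}) P
    (Y : Omega -> E) (f : E -> R) : Prop :=
  measurable_fun [set: Omega] Y /\
  forall A : set E, measurable A -> P (Y @^-1` A) = \int[mu]_(x in A) (f x)%:E.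

(* Time starts at 1, so X 0 is never constrained nor used. *)
Definition independent_from1 P X : Prop :=
  forall (s : seq nat) (A : nat -> set E),
    uniq s -> (forall t, t \in s -> (1 <= t)%N) ->
    (forall t, measurable (A t)) ->
    P (\bigcap_(t in [set` s]) (X t @^-1` A t)) =
    \prod_(t <- s) P (X t @^-1` A t).

Definition change_law (mu : {measure set E -> \bar R}) (f0 f1 : E -> R)
    (nu : nat) P X : Prop :=
  independent_from1 P X /\
  forall t, (1 <= t)%N ->
    has_density mu P (X t) (if (t < nu)%N then f0 else f1).

(* If P A = 0, the value is 0 / 0 = 0 * +oo = 0. *)
Definition cond_expectation P (Y : Omega -> \bar R) (A : set Omega) : \bar R :=
  (\int[P]_(w in A) Y w) / P A.

(* P nu is the probability measure under which the change occurs at nu. *)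
Definition WADD (P : nat -> probability Omega R) (T : Omega -> \bar R) :
    \bar R :=
  ereal_sup [set cond_expectation (P nu) (fun w => T w - (nu%:R)%:E)
                   [set w | (nu%:R)%:E <= T w]
            | nu in [set nu | (1 <= nu)%N]].

End model.

Section scusum.
Context (R : realType).

Fixpoint cusumW (b0 : R) (W : nat -> \bar R) (t : nat) : \bar R :=
  if t is s.+1 then
    if cusumW b0 W s < b0%:E then maxe (cusumW b0 W s + W t) 0
    else cusumW b0 W s
  else 0.

Fixpoint cusumS (b0 : R) (W L : nat -> \bar R) (t : nat) : \bar R :=
  if t is s.+1 then
    if cusumW b0 W t < b0%:E then 0
    else maxe (cusumS b0 W L s + L t) 0
  else 0.

(* The infimum of the empty set is +oo: no alarm is ever raised. *)
Definition T_S (d dO : measure_display) (E : measurableType d)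
    (Omega : measurableType dO) (f0 fC fB : E -> R)
    (X : nat -> Omega -> E) (b0 bC : R) (w : Omega) : \bar R :=
  let W t := llr fB f0 (X t w) in
  let L t := llr fB fC (X t w) in
  ereal_inf [set (t%:R)%:E | t in
    [set t : nat | [/\ (1 <= t)%N, b0%:E <= cusumW b0 W t &
                       bC%:E <= cusumS b0 W L t]]].

End scusum.

(* Main.v *)
(* While CuSum_W is below b, its increments dominate those of the random walk of
   the scores W capped at some level M0, and likewise in the second stage for
   Lambda capped at MC. Under f_B the capped walks have means at least K0 and KC,
   where K0 and KC may be taken arbitrarily close to the divergences (arbitrarily
   large if infinite). Hence the potential equal to
     (b + M0 - CuSum_W) / K0 + (b + MC) / KC  in the first stage,
     (b + MC - CuSum_Lambda) / KC             in the second stage,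
   and 0 after the alarm, is nonnegative and decreases in mean by at least 1 per
   observation from time nu on, whatever the history up to nu. Summing the
   probabilities of no alarm yet bounds the conditional delay by
   (b + M0) / K0 + (b + MC) / KC, uniformly in nu. *)
Require Import Defs.
From mathcomp Require Import measurable_realfun ring lra.

Set Implicit Arguments.
Unset Strict Implicit.
Unset Printing Implicit Defensive.

Local Open Scope classical_set_scope.
Local Open Scope ring_scope.
Local Open Scope ereal_scope.

(** * Integration against a measure given by a density *)

Section density_measure.
Import HBNNSimple.

(** By monotone convergence both sides are limits along simple functions increasing to [psi]; for
    these the identity is [nuE] on each level set. *)
Lemma ge0_integral_density (R : realType) (d : measure_display)
    (T : measurableType d) (mu nu : {measure set T -> \bar R}) (f : T -> R)
    (mf : measurable_fun setT f) (f0 : forall x, (0 <= f x)%R)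
    (nuE : forall A, measurable A -> nu A = \int[mu]_(x in A) (f x)%:E)
    (psi : T -> \bar R) (mpsi : measurable_fun setT psi)
    (psi0 : forall x, 0 <= psi x) :
  \int[nu]_x psi x = \int[mu]_x (psi x * (f x)%:E).
Proof.
have mfE : measurable_fun setT (EFin \o f) by exact/measurable_EFinP.
pose h := nnsfun_approx measurableT mpsi.
have hpsi x : (h n x)%:E @[n --> \oo] --> psi x.
  by apply: cvg_nnsfun_approx.
have hnd x : {homo (fun n => (h n x)%:E) : n m / (n <= m)%N >-> n <= m}.
  by move=> n m nm; rewrite lee_fin; exact/lefP/nd_nnsfun_approx.
have mh n : measurable_fun setT (fun x => (h n x)%:E) by exact/measurable_EFinP.
transitivity (limn (fun n => \int[nu]_x (h n x)%:E)).
  rewrite -monotone_convergence//.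
  - by apply: eq_integral => x _; apply/esym/cvg_lim => //; exact: hpsi.
  - by move=> n x _; rewrite lee_fin.
transitivity (limn (fun n => \int[mu]_x ((h n x)%:E * (f x)%:E))); last first.
  rewrite -monotone_convergence//.
  - apply: eq_integral => x _; apply/cvg_lim => //.
    by apply: cvgeZr => //; exact: hpsi.
  - by move=> n; exact: emeasurable_funM.
  - by move=> n x _; rewrite mule_ge0 ?lee_fin.
  - by move=> x _ n m nm; rewrite lee_wpmul2r ?lee_fin// -lee_fin hnd.
congr (lim (_ @ \oo)); apply/funext => n.
rewrite integralT_nnsfun sintegralE.
have hE x : (h n x)%:E = \sum_(y \in range (h n)) (y * \1_(h n @^-1` [set y]) x)%:E.
  by rewrite fimfunE fsumEFin.
under [RHS]eq_integral => x _.
  rewrite hE ge0_mule_fsuml; last by move=> y; exact: nnfun_muleindic_ge0.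
  over.
rewrite ge0_integral_fsum//; last 2 first.
  - move=> y; apply: emeasurable_funM => //; apply/measurable_EFinP.
    by apply: measurable_funM.
  - by move=> y x _; rewrite mule_ge0 ?nnfun_muleindic_ge0 ?lee_fin.
apply: eq_fsbigr => y; rewrite inE => -[t _ <-].
rewrite nuE//.
under [RHS]eq_integral do rewrite EFinM -muleA.
rewrite ge0_integralZl//; last 3 first.
  - by apply: emeasurable_funM => //; exact/measurable_EFinP.
  - by move=> x _; rewrite mule_ge0 ?lee_fin.
  - by rewrite lee_fin.
congr (_ * _).
rewrite integral_mkcond; apply: eq_integral => x _.
by rewrite muleC epatch_indic.
Qed.
End density_measure.

(** * Independence of the next observation from the history *)

(* The pi-system generating the history sigma(X_1, ..., X_n). *)
Definition cylinders (d dO : measure_display) (E : measurableType d)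
    (Omega : measurableType dO) (X : nat -> Omega -> E) (n : nat) :
    set (set Omega) :=
  [set A | exists2 B : nat -> set E, (forall t, measurable (B t)) &
    A = \bigcap_(t in [set` iota 1 n]) (X t @^-1` B t)].

Lemma cylinders_setI (d dO : measure_display) (E : measurableType d)
    (Omega : measurableType dO) (X : nat -> Omega -> E) (n : nat) :
  setI_closed (cylinders X n).
Proof.
move=> _ _ [A mA ->] [B mB ->]; exists (fun t => A t `&` B t).
  by move=> t; exact: measurableI.
by rewrite -bigcapI.
Qed.

Lemma measurable_fun_cylinders (d dO : measure_display) (E : measurableType d)
    (Omega : measurableType dO) (X : nat -> Omega -> E) (n t : nat) :
  (1 <= t <= n)%N ->
  measurable_fun [set: g_sigma_algebraType (cylinders X n)]
    (X t : g_sigma_algebraType (cylinders X n) -> E).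
Proof.
move=> tn _ B mB; rewrite setTI; apply: sub_sigma_algebra.
exists (fun s => if s == t then B else setT).
  by move=> s; case: ifP.
apply/seteqP; split=> w /=.
  by move=> Bw s _ /=; case: eqP => // ->.
by move=> /(_ t); rewrite /= eqxx; apply; rewrite mem_iota add1n ltnS.
Qed.

(** Dynkin's argument: for fixed [B] the good sets [G] are stable under complements and countable
    disjoint unions, and include the cylinders. Measurability of [G] in [Omega] is part of the
    induction because these closure steps use it. *)
Lemma independent_history (R : realType) (d dO : measure_display)
    (E : measurableType d) (Omega : measurableType dO)
    (P : probability Omega R) (X : nat -> Omega -> E)
    (mX : forall t, (1 <= t)%N -> measurable_fun setT (X t))
    (indX : independent_from1 P X) (n : nat) (G : set Omega) (B : set E) :
  <<s cylinders X n >> G -> measurable B ->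
  measurable G /\ P (G `&` X n.+1 @^-1` B) = P G * P (X n.+1 @^-1` B).
Proof.
move=> sG mB; set F := X n.+1 @^-1` B.
have mF : measurable F by rewrite /F -[_ @^-1` _]setTI; exact: mX.
have indepC (A : set Omega) : measurable A -> P (A `&` F) = P A * P F ->
    measurable (~` A) /\ P (~` A `&` F) = P (~` A) * P F.
  move=> mA PA; split; first exact: measurableC.
  rewrite probability_setC// setIC -setDE measureD//; last first.
    by rewrite -ge0_fin_numE// fin_num_measure.
  transitivity (P F - P A * P F).
    by congr (_ - _); rewrite setIC; exact: PA.
  by rewrite muleBl ?mul1e// ?fin_num_measure.
have indep_bigcup (A : (set Omega)^nat) : trivIset setT A ->
    (forall k, measurable (A k) /\ P (A k `&` F) = P (A k) * P F) ->
    measurable (\bigcup_k A k) /\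
    P (\bigcup_k A k `&` F) = P (\bigcup_k A k) * P F.
  move=> tA mPA.
  have mA k : measurable (A k) by have [] := mPA k.
  split; first exact: bigcup_measurable.
  rewrite setI_bigcupl measure_bigcup//; last 2 first.
    by move=> k _; exact: measurableI.
    exact: trivIset_setIr.
  have PF : P F = (fine (P F))%:E by rewrite fineK ?fin_num_measure.
  rewrite measure_bigcup// muleC PF -nneseriesZl//.
  by apply: eq_eseriesr => k _; rewrite -PF muleC; have [] := mPA k.
move: G sG; apply: (@dynkin_induction _ (g_sigma_algebraType (cylinders X n))).
- by [].
- exact: cylinders_setI.
- by split=> //; rewrite setTI probability_setT mul1e.
- move=> _ [A mA ->].
  have tn t : t \in iota 1 n -> (1 <= t)%N by rewrite mem_iota => /andP[].
  split.
    apply: fin_bigcap_measurable; first exact: finite_seq.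
    by move=> t /= /tn t1; rewrite -[_ @^-1` _]setTI; exact: mX.
  (* Placing [B] at time [n.+1] gives one cylinder over the times 1 to [n.+1], to which [indX]
     applies. *)
  pose A' t := if t == n.+1 then B else A t.
  have nn : n.+1 \notin iota 1 n by rewrite mem_iota add1n ltnn andbF.
  have mA' t : measurable (A' t) by rewrite /A'; case: ifP.
  rewrite (_ : _ `&` F = \bigcap_(t in [set` rcons (iota 1 n) n.+1]) (X t @^-1` A' t)).
    rewrite indX//.
    - rewrite big_rcons/= {2}/A' eqxx; congr (_ * _).
      rewrite indX ?iota_uniq//; apply: eq_big_seq => t tn'.
      by rewrite /A' ifN//; apply: contraNN nn => /eqP <-.
    - by rewrite rcons_uniq nn iota_uniq.
    - by move=> t; rewrite mem_rcons inE => /predU1P[->|/tn].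
  apply/seteqP; split=> w /=.
    move=> [Aw Fw] t /=; rewrite mem_rcons inE => /predU1P[->|tn'].
      by rewrite /A' eqxx.
    rewrite /A' ifN; first exact: Aw.
    by apply: contraNN nn => /eqP <-.
  move=> H; split.
    move=> t /= tn'; have := H t; rewrite /= mem_rcons inE tn' orbT => /(_ isT).
    by rewrite /A' ifN//; apply: contraNN nn => /eqP <-.
  by have := H n.+1; rewrite /= mem_rcons inE eqxx => /(_ isT); rewrite /A' eqxx.
- by move=> A _ []; exact: indepC.
- by move=> A _ tA mPA; exact: indep_bigcup.
Qed.

(** By independence, the law of [X n.+1] under [P] restricted to [G] has density [P G * f] with
    respect to [mu]. *)
Lemma ge0_integral_independent_history (R : realType) (d dO : measure_display)
    (E : measurableType d) (Omega : measurableType dO)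
    (mu : {measure set E -> \bar R}) (P : probability Omega R)
    (X : nat -> Omega -> E) (f : E -> R)
    (mX : forall t, (1 <= t)%N -> measurable_fun setT (X t))
    (indX : independent_from1 P X) (n : nat) (G : set Omega)
    (mf : measurable_fun setT f) (f0 : forall x, (0 <= f x)%R)
    (fX : has_density mu P (X n.+1) f)
    (psi : E -> \bar R) (mpsi : measurable_fun setT psi)
    (psi0 : forall x, 0 <= psi x) :
  <<s cylinders X n >> G ->
  \int[P]_w (psi (X n.+1 w) * (\1_G w)%:E) = P G * \int[mu]_x (psi x * (f x)%:E).
Proof.
move=> sG.
have [mG _] := independent_history mX indX sG measurableT.
have mfE : measurable_fun setT (EFin \o f) by exact/measurable_EFinP.
have mXn : measurable_fun setT (X n.+1) by exact: mX.
have PG : P G = (fine (P G))%:E by rewrite fineK ?fin_num_measure.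
have PG0 : (0 <= fine (P G))%R by rewrite fine_ge0.
pose PX' : {measure set E -> \bar R} := pushforward (mrestr P mG) (X n.+1).
pose PX := PX' mXn.
transitivity (\int[PX]_x psi x).
  rewrite ge0_integral_pushforward//= preimage_setT.
  rewrite -(@ge0_integral_density _ _ _ P (mrestr P mG) (\1_G))//.
  - by move=> A mA; rewrite integral_indic// setIC.
  - exact: measurableT_comp.
rewrite (@ge0_integral_density _ _ _ mu PX (fun x => fine (P G) * f x)%R)//.
- under eq_integral do rewrite EFinM muleCA.
  rewrite ge0_integralZl -?PG//.
    by apply: emeasurable_funM.
  by move=> x _; rewrite mule_ge0 ?lee_fin.
- exact: measurable_funM.
- by move=> x; rewrite mulr_ge0.
move=> A mA; rewrite /PX /PX'/= /pushforward /mrestr setIC.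
have [_ ->] := independent_history mX indX sG mA.
case: fX => _ ->//; under [RHS]eq_integral do rewrite EFinM.
rewrite ge0_integralZl -?PG//; first exact: measurable_funTS.
by move=> x _; rewrite lee_fin.
Qed.

(** * Log-likelihood ratios and truncation of the Kullback-Leibler divergence *)

Section llr_theory.
Context (R : realType) (d : measure_display) (E : measurableType d).
Variables (mu : {measure set E -> \bar R}) (f g : E -> R).
Hypotheses (hf : is_density mu f) (hg : is_density mu g).

Let mf : measurable_fun setT f. Proof. by case: hf. Qed.
Let mg : measurable_fun setT g. Proof. by case: hg. Qed.
Let f0 x : (0 <= f x)%R. Proof. by case: hf. Qed.
Let g0 x : (0 <= g x)%R. Proof. by case: hg. Qed.

Lemma llrE x : llr f g x =
  if (f x <= 0)%R then -oo else
  if (g x <= 0)%R then +oo else (ln (f x) - ln (g x))%:E.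
Proof.
rewrite /llr; case: ifPn => [fx|].
  have -> : f x = 0%R by apply/eqP; rewrite eq_le fx f0.
  by rewrite mul0e le0_lneNy.
rewrite -ltNge => fx; case: ifPn => [gx|].
  have -> : g x = 0%R by apply/eqP; rewrite eq_le gx g0.
  by rewrite inve0 gt0_muley ?lte_fin.
rewrite -ltNge => gx; rewrite inver gt_eqF// -EFinM lne_EFin ?divr_gt0//.
by rewrite ln_div ?posrE.
Qed.

Lemma measurable_llr : measurable_fun setT (llr f g).
Proof.
rewrite (_ : llr f g = fun x => if (f x <= 0)%R then -oo else
  if (g x <= 0)%R then +oo else (ln (f x) - ln (g x))%:E); last exact/funext/llrE.
apply: measurable_fun_ifT => //; first exact: measurable_fun_ler.
apply: measurable_fun_ifT => //; first exact: measurable_fun_ler.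
apply/measurable_EFinP/measurable_funB;
  by apply: measurableT_comp => //; exact: measurable_ln.
Qed.

(** This is [ln u <= u - 1] at [u = g x / f x], multiplied by [f x]. *)
Lemma le_llr_mul x : (f x - g x)%:E <= llr f g x * (f x)%:E.
Proof.
rewrite llrE; case: ifPn => [fx|].
  have -> : f x = 0%R by apply/eqP; rewrite eq_le fx f0.
  by rewrite mule0 sub0r lee_fin oppr_le0.
rewrite -ltNge => fx; case: ifPn => [gx|].
  by rewrite gt0_mulye ?lte_fin// leey.
rewrite -ltNge => gx; rewrite -EFinM lee_fin.
have gf : (0 < g x / f x)%R by rewrite divr_gt0.
have : (ln (1 + (g x / f x - 1)) <= g x / f x - 1)%R.
  by apply: le_ln1Dx; lra.
rewrite (_ : 1 + _ = (f x / g x)^-1)%R; last by rewrite invf_div; lra.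
rewrite lnV ?posrE ?divr_gt0// ln_div ?posrE// => /(ler_wpM2r (ltW fx)).
by rewrite mulrBl divfK ?gt_eqF//; lra.
Qed.

Let F := fun x => llr f g x * (f x)%:E.

Let mF : measurable_fun setT F.
Proof.
apply: emeasurable_funM; first exact: measurable_llr.
exact/measurable_EFinP.
Qed.

Let intf : \int[mu]_x (f x)%:E = 1. Proof. by case: hf. Qed.
Let intg : \int[mu]_x (g x)%:E = 1. Proof. by case: hg. Qed.
Let mfE : measurable_fun setT (EFin \o f). Proof. exact/measurable_EFinP. Qed.
Let mgE : measurable_fun setT (EFin \o g). Proof. exact/measurable_EFinP. Qed.

(** A form of [le_llr_mul] with nonnegative terms only, which can be integrated even where [F] is
    infinite. *)
Let Fneg_le x : F^\- x + (f x)%:E <= F^\+ x + (g x)%:E.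
Proof.
have := le_llr_mul x; rewrite funenegE ?funeposE -/(F x).
case: (F x) => [r| |]//=; last by rewrite maxye addye ?leey.
rewrite -!EFin_max -!EFinD !lee_fin => ?; have [?|?] := leP r 0%R;
  have [?|?] := leP (- r)%R 0%R; lra.
Qed.

(** Since [F >= f - g >= - g], the negative part is at most [g], of mass 1. Hence [KL] is never an
    undetermined difference of infinities. *)
Let int_Fneg : \int[mu]_x F^\- x \is a fin_num.
Proof.
rewrite ge0_fin_numE; last by apply: integral_ge0 => x _; exact: funeneg_ge0.
apply: (@le_lt_trans _ _ 1); last exact: ltry.
rewrite -intg; apply: ge0_le_integral => //; first exact: measurable_funeneg.
move=> x _; have := Fneg_le x; have := le_llr_mul x.
rewrite funenegE ?funeposE -/(F x); have := f0 x; have := g0 x.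
case: (F x) => [r| |]//=; last by move=> ?; rewrite maxNye lee_fin.
rewrite -!EFin_max -!EFinD !lee_fin => ? ? ? ?; have [?|?] := leP r 0%R;
  have [?|?] := leP (- r)%R 0%R; lra.
Qed.

Lemma KL_ge0 : 0 <= KL mu f g.
Proof.
rewrite /KL integralE sube_ge0; last by rewrite int_Fneg.
(* The 1 added to both sides is read as the integral of [f] on the left and of [g] on the right,
   which reduces the claim to [Fneg_le]. *)
rewrite -(@leeD2rE _ 1)// -{1}intf -intg -!ge0_integralD//.
all: try by move=> x _; rewrite ?funepos_ge0 ?funeneg_ge0 ?lee_fin.
all: try by [exact: measurable_funepos|exact: measurable_funeneg].
apply: ge0_le_integral => //.
- by move=> x _; rewrite adde_ge0 ?funeneg_ge0 ?lee_fin.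
- by apply: emeasurable_funD => //; exact: measurable_funeneg.
- by apply: emeasurable_funD => //; exact: measurable_funepos.
Qed.

Let trunc (n : nat) x := mine (maxe (llr f g x) 0) n%:R%:E * (f x)%:E.

Let trunc_ge0 n x : 0 <= trunc n x.
Proof. by rewrite mule_ge0 ?lee_fin// le_min lee_fin ler0n le_max lexx orbT. Qed.

Let measurable_trunc n : measurable_fun setT (trunc n).
Proof.
apply: emeasurable_funM => //; apply: measurable_mine => //.
by apply: measurable_maxe => //; exact: measurable_llr.
Qed.

Let trunc_cvg x : trunc ^~ x @ \oo --> F^\+ x.
Proof.
have -> : F^\+ x = maxe (llr f g x) 0 * (f x)%:E.
  by rewrite funeposE maxe_pMl ?lee_fin// mul0e.
apply: cvgeZr => //.
case: (maxe _ _) => [r| |].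
- apply: cvg_near_cst; near=> n.
  by apply/min_idPl; rewrite lee_fin; near: n; exact: nbhs_infty_ger.
- rewrite (_ : (fun n => _) = fun n => n%:R%:E); last first.
    by apply/funext => n; rewrite min_r ?leey.
  by apply/cvgeryP; exact: cvgr_idn.
- by apply: cvg_near_cst; near=> n; rewrite min_l ?leNye.
Unshelve. all: end_near.
Qed.

Let int_trunc_cvg : \int[mu]_x trunc n x @[n --> \oo] --> \int[mu]_x F^\+ x.
Proof.
rewrite (_ : \int[mu]_x F^\+ x = \int[mu]_x limn (trunc ^~ x)).
  apply: cvg_monotone_convergence => // x _ n m nm.
  rewrite lee_wpmul2r ?lee_fin// le_min ge_min lexx/= ge_min.
  by rewrite lee_fin ler_nat nm orbT.
by apply: eq_integral => x _; apply/esym/cvg_lim => //; exact: trunc_cvg.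
Qed.

(** With [x] the score, this is [(n - x)^+ + min(x^+, n) = n + x^-], weighted by [f]. *)
Let truncE n x :
  maxe (n%:R%:E - llr f g x) 0 * (f x)%:E + trunc n x = (n%:R * f x)%:E + F^\- x.
Proof.
rewrite funenegE /F /trunc llrE; case: ifPn => [fx|].
  have -> : f x = 0%R by apply/eqP; rewrite eq_le fx f0.
  by rewrite !mule0 mulr0 oppe0 maxxx.
rewrite -ltNge => fx; case: ifPn => [gx|gx].
  by rewrite /= gt0_mulye ?lte_fin//= !maxNye maxye minye mul0e add0e adde0 EFinM.
set r := (_ - _)%R.
rewrite -EFinM -!EFinN -!EFinD -!EFin_max -EFin_min -!EFinM -!EFinD.
have n0 : (0 <= n%:R :> R)%R by [].
congr EFin; have [r0|r0] := leP r 0%R.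
  rewrite (max_idPl _) 1?(min_idPl _)// ?(max_idPl _)//; [nra|nra|lra].
rewrite [Num.max (- _)%R _](max_idPr _); last by nra.
have [rn|rn] := leP r n%:R; last by rewrite (max_idPr _); [nra|lra].
by rewrite (max_idPl _); [nra|lra].
Qed.

(* As M - (M - x)^+ = min(x, M), this says that the score log (f / g), capped
   at M, keeps a mean of at least K under f. *)
Lemma KL_truncation (K : R) : K%:E < KL mu f g ->
  exists2 M : R, (0 <= M)%R &
    \int[mu]_x (maxe (M%:E - llr f g x) 0 * (f x)%:E) <= (M - K)%:E.
Proof.
rewrite /KL integralE lteBrDr// => KF.
(* By monotone convergence, the positive part capped at a large [n] already has a mean above [K]
   plus that of the negative part; this [n] is the cap [M]. *)
have [n Kn] : exists n, K%:E + \int[mu]_x F^\- x < \int[mu]_x trunc n x.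
  apply/not_existsP => H; move: KF; apply/negP; rewrite -leNgt.
  have /cvg_lim <- // := int_trunc_cvg.
  apply: lime_le; first by apply/cvg_ex; eexists; exact: int_trunc_cvg.
  by apply: nearW => n; rewrite leNgt; apply/negP/H.
pose G x := maxe (n%:R%:E - llr f g x) 0 * (f x)%:E.
have G0 x : 0 <= G x by rewrite mule_ge0 ?lee_fin// le_max lexx orbT.
have mG : measurable_fun setT G.
  apply: emeasurable_funM => //; apply: measurable_maxe => //.
  by apply: emeasurable_funB => //; exact: measurable_llr.
exists n%:R => //; suff : \int[mu]_x G x <= (n%:R - K)%:E by [].
(* By [truncE] the integral of [G] is [n] plus that of [F^\-] minus that of [trunc n], hence below
   [n - K]. *)
have : \int[mu]_x (G x + trunc n x) = \int[mu]_x ((n%:R * f x)%:E + F^\- x).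
  by apply: eq_integral => x _; exact: truncE.
rewrite !ge0_integralD//; last 3 first.
- by move=> x _; rewrite lee_fin mulr_ge0.
- by apply/measurable_EFinP; exact: measurable_funM.
- exact: measurable_funeneg.
have -> : \int[mu]_x (n%:R * f x)%:E = n%:R%:E.
  under eq_integral do rewrite EFinM.
  by rewrite ge0_integralZl_EFin ?intf ?mule1// => x _; rewrite lee_fin.
have : 0 <= \int[mu]_x G x by apply: integral_ge0.
move: Kn int_Fneg.
case: (\int[mu]_x F^\- x) => [c| |]//; case: (\int[mu]_x trunc n x) => [b| |]//;
  case: (\int[mu]_x G x) => [a| |]//.
rewrite -!EFinD lte_fin => Kb _ _ [abc]; rewrite lee_fin; lra.
Qed.

End llr_theory.

(** * The first alarm time of an arbitrary alarm sequence *)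

Section first_alarm.
Context (R : realType) (alarm : nat -> bool).

Let T : \bar R := ereal_inf [set (t%:R)%:E | t in
  [set t : nat | (1 <= t)%N /\ alarm t]].

Definition silent (n : nat) : bool := ~~ has alarm (iota 1 n).

Lemma silentS n : silent n.+1 = silent n && ~~ alarm n.+1.
Proof. by rewrite /silent -[in LHS](addn1 n) iotaD has_cat /= orbF negb_or add1n. Qed.

Lemma silent_le m n : (m <= n)%N -> silent n -> silent m.
Proof.
move=> /subnKC <-; elim: (n - m)%N => [|k IH]; first by rewrite addn0.
by rewrite addnS silentS => /andP[/IH].
Qed.

Lemma alarm_not_silent t n : (1 <= t <= n)%N -> alarm t -> silent n = false.
Proof.
move=> tn at_; apply/negbTE; rewrite negbK; apply/hasP; exists t => //.
by rewrite mem_iota add1n ltnS.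
Qed.

(** The event [T >= nu] only excludes alarms at the times 1 to [nu - 1], hence the predecessor. *)
Lemma le_first_alarm (nu : nat) : (1 <= nu)%N -> ((nu%:R)%:E <= T) = silent nu.-1.
Proof.
move=> nu1; apply/idP/idP => [nuT|sil].
  apply/negP => /hasP[t]; rewrite mem_iota add1n prednK// => /andP[t1 tnu] at_.
  have : (nu%:R)%:E <= (t%:R)%:E :> \bar R.
    by apply: le_trans nuT _; apply: ereal_inf_lbound; exists t.
  by rewrite lee_fin ler_nat leqNgt tnu.
apply: le_ereal_inf_tmp => _ [t [t1 at_] <-]; rewrite lee_fin ler_nat leqNgt.
apply/negP => tnu; move: sil; rewrite (alarm_not_silent _ at_)// t1/=.
by rewrite -ltnS prednK.
Qed.

(** Tail-sum formula: [silent (nu + n)] says [T > nu + n], so the series counts the integers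
    [n >= 0] below [T - nu]. Without any alarm all its terms are 1. *)
Lemma first_alarm_sub (nu : nat) : silent nu.-1 -> (1 <= nu)%N ->
  T - (nu%:R)%:E = \sum_(0 <= n <oo) ((silent (nu + n))%:R)%:E.
Proof.
move=> sil nu1; have [[t0 /andP[t01 at0]]|none] :=
    pselect (exists t : nat, (1 <= t)%N && alarm t).
  have ex : exists t, (1 <= t)%N && alarm t by exists t0; rewrite t01.
  case: (ex_minnP ex) => t /andP[t1 at_] tmin.
  have TE : T = (t%:R)%:E.
    apply/eqP; rewrite eq_le; apply/andP; split.
      by apply: ereal_inf_lbound; exists t.
    apply: le_ereal_inf_tmp => _ [s [s1 as_] <-]; rewrite lee_fin ler_nat.
    by apply: tmin; rewrite s1.
  have silE n : silent n = (n < t)%N.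
    rewrite ltnNge; have [tn|nt] := leqP t n.
      by rewrite (alarm_not_silent _ at_)// t1.
    apply/negP => /hasP[s]; rewrite mem_iota add1n ltnS => /andP[s1 sn] as_.
    by have := tmin s; rewrite s1 as_ => /(_ isT); rewrite leqNgt (leq_ltn_trans sn).
  have nut : (nu <= t)%N by move: sil; rewrite silE -ltnS prednK.
  rewrite TE -EFinB -natrB//.
  rewrite (nneseries_split 0 (t - nu)); last by move=> k _; rewrite lee_fin.
  rewrite add0n [X in _ + X]eseries0 ?adde0; last first.
    move=> k; rewrite /= leq_subLR silE => tk _.
    by rewrite ltnNge tk.
  rewrite big_nat (eq_bigr (fun=> 1)); last first.
    by move=> k /=; rewrite silE ltn_subRL => ->.
  rewrite -big_nat sumEFin.
  by rewrite big_const_nat subn0 iter_addr_0.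
have silT n : silent n.
  apply/negP => /hasP[s]; rewrite mem_iota => /andP[s1 _] as_.
  by apply: none; exists s; rewrite s1.
have -> : T = +oo.
  rewrite /T (_ : [set _ | _ in _] = set0) ?ereal_inf0//.
  by apply/seteqP; split => // x [t [t1 at_] _]; apply: none; exists t; rewrite t1.
rewrite addye//; apply/esym/eqyP => r r0.
apply: le_trans (nneseries_lim_ge (Num.truncn r).+1 _); last first.
  by move=> k _ _; rewrite lee_fin.
under eq_bigr do rewrite silT.
rewrite sumEFin big_const_nat subn0 iter_addr_0 lee_fin.
by apply: ltW; exact: truncnS_gt.
Qed.

End first_alarm.

(** * Pathwise decrease of the potential *)

Section potential.
Context (R : realType) (b M0 MC K0 KC : R) (W L : nat -> \bar R).
Hypotheses (b0 : (0 < b)%R) (M00 : (0 <= M0)%R) (MC0 : (0 <= MC)%R)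
  (K00 : (0 < K0)%R) (KC0 : (0 < KC)%R).

Definition raises_alarm (t : nat) : bool :=
  (b%:E <= cusumW b W t) && (b%:E <= cusumS b W L t).

Definition stage0 (n : nat) : bool :=
  silent raises_alarm n && (cusumW b W n < b%:E).

Definition stageC (n : nat) : bool :=
  silent raises_alarm n && (b%:E <= cusumW b W n).

(** Equal to [M - min(x, M)]. Unlike the capped score it is nonnegative, so its integral makes sense
    even for scores equal to -oo. *)
Definition excess (M : R) (x : \bar R) : \bar R := maxe (M%:E - x) 0.

(* Bounds the expected remaining time to the alarm once the change has occurred:
   a stage lasts at most (missing height + overshoot M) / (drift K). *)
Definition potential (n : nat) : R :=
  if silent raises_alarm n then
    if cusumW b W n < b%:E then
      ((b + M0 - fine (cusumW b W n)) / K0 + (b + MC) / KC)%R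
    else ((b + MC - fine (cusumS b W L n)) / KC)%R
  else 0%R.

Lemma excess_ge0 M x : 0 <= excess M x.
Proof. by rewrite /excess le_max lexx orbT. Qed.

Lemma cusumW_ge0 n : 0 <= cusumW b W n.
Proof. by elim: n => //= n IH; case: ifP => _ //; rewrite le_max lexx orbT. Qed.

Lemma cusumS_ge0 n : 0 <= cusumS b W L n.
Proof. by case: n => //= n; case: ifP => _ //; rewrite le_max lexx orbT. Qed.

Let below_real (x : \bar R) : 0 <= x -> x < b%:E ->
  exists2 r, x = r%:E & (0 <= r < b)%R.
Proof. by case: x => [r| |]//; rewrite lee_fin lte_fin => r0 rb; exists r; rewrite ?r0. Qed.

Let silent_stageC n : silent raises_alarm n -> b%:E <= cusumW b W n ->
  cusumS b W L n < b%:E.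
Proof.
case: n => [_ _|n]; first by rewrite /= lte_fin.
by rewrite silentS /raises_alarm => /andP[_] /[swap] ->; rewrite -ltNge.
Qed.

Lemma potential_ge0 n : (0 <= potential n)%R.
Proof.
have [[b_gt0 M0_ge0] MC_ge0] := (b0, M00, MC0).
rewrite /potential; case: ifPn => // sil; case: ifPn => [wb|].
  have [r -> /andP[r0 rb]] := below_real (cusumW_ge0 n) wb.
  by rewrite addr_ge0// divr_ge0 ?(ltW K00) ?(ltW KC0)//=; lra.
rewrite -leNgt => bw.
have [r -> /andP[r0 rb]] := below_real (cusumS_ge0 n) (silent_stageC sil bw).
by rewrite divr_ge0 ?(ltW KC0)//=; lra.
Qed.

Lemma potential_le n :
  (potential n <= ((b + M0) / K0 + (b + MC) / KC) * (silent raises_alarm n)%:R)%R.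
Proof.
have [[b_gt0 M0_ge0] MC_ge0] := (b0, M00, MC0).
rewrite /potential; case: ifPn => [sil|_]; last by rewrite mulr0.
rewrite mulr1; case: ifPn => [wb|].
  have [r -> /andP[r0 rb]] := below_real (cusumW_ge0 n) wb.
  by rewrite lerD2r ler_pM2r ?invr_gt0//=; lra.
rewrite -leNgt => bw.
have [r -> /andP[r0 rb]] := below_real (cusumS_ge0 n) (silent_stageC sil bw).
apply: (@le_trans _ _ ((b + MC) / KC)%R); last first.
  by rewrite lerDr divr_ge0 ?(ltW K00)//; lra.
by rewrite ler_pM2r ?invr_gt0//=; lra.
Qed.

(** The positive part only raises the statistic: the increment [r - w] is at least [x], so
    [M - (r - w) <= M - x]. *)
Let excess_step M (w r : R) x : maxe (w%:E + x) 0 = r%:E ->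
  (M + w - r)%:E <= excess M x.
Proof.
rewrite /excess; case: x => [y| |] /=; [|by rewrite maxye|by rewrite maxye leey].
rewrite -!EFinD -!EFin_max lee_fin => -[<-].
rewrite le_max; apply/orP; left.
by have [?|?] := leP (w + y)%R 0%R; lra.
Qed.

(** In the first stage the potential drops by at least [(M0 - excess) / K0], the capped score
    divided by the drift; likewise in the second. The terms are arranged so that both sides are
    nonnegative and can be integrated. *)
Lemma potential_step n :
  (potential n.+1 + M0 / K0 * (stage0 n)%:R + MC / KC * (stageC n)%:R)%:E <=
  (potential n)%:E + (K0^-1)%:E * (excess M0 (W n.+1) * ((stage0 n)%:R)%:E)
                   + (KC^-1)%:E * (excess MC (L n.+1) * ((stageC n)%:R)%:E).
Proof.
have [[b_gt0 M0_ge0] MC_ge0] := (b0, M00, MC0).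
rewrite /stage0 /stageC.
have [sil|nsil] := boolP (silent raises_alarm n); last first.
  rewrite /potential silentS (negbTE nsil)/=.
  by rewrite !(mulr0, mule0, addr0, adde0).
rewrite /= ltNge; have [bw|wb] /= := leP b%:E (cusumW b W n).
  rewrite !(mulr0, mulr1, mule0, mule1, addr0, adde0).
  have [s Es /andP[s0 sb]] := below_real (cusumS_ge0 n) (silent_stageC sil bw).
  have WE : cusumW b W n.+1 = cusumW b W n by rewrite /= ltNge bw.
  have SE : cusumS b W L n.+1 = maxe (s%:E + L n.+1) 0.
    by rewrite [LHS]/= -/(cusumW b W n.+1) WE ltNge bw/= Es.
  have -> : potential n = ((b + MC - s) / KC)%R.
    by rewrite /potential sil ltNge bw/= Es.
  (* A score of -oo makes the right-hand side +oo; otherwise all terms are real. *)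
  have [exy|exr] := eqVneq (excess MC (L n.+1)) +oo.
    by rewrite exy gt0_muley ?lte_fin ?invr_gt0// addey// leey.
  have [x Ex x0] : exists2 x, excess MC (L n.+1) = x%:E & (0 <= x)%R.
    move: exr (excess_ge0 MC (L n.+1)).
    by case: (excess MC (L n.+1)) => [x| |]//; exists x.
  rewrite Ex -EFinM -EFinD lee_fin [(KC^-1 * x)%R]mulrC -!mulrDl.
  rewrite /potential silentS sil WE ltNge bw/= /raises_alarm WE bw/= -ltNge.
  (* At an alarm the new potential is 0, and [s < b] with [x >= 0] suffices to cover [MC / KC]. *)
  case: ifPn => [Sb|_]; last by rewrite add0r ler_pM2r ?invr_gt0//; lra.
  have [r Er /andP[r0 rb]] := below_real (cusumS_ge0 n.+1) Sb.
  rewrite -mulrDl ler_pM2r ?invr_gt0// -/(cusumS b W L n.+1) Er/=.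
  by have := @excess_step MC s r (L n.+1); rewrite -SE => /(_ Er); rewrite Ex lee_fin; lra.
rewrite !(mulr0, mulr1, mule0, mule1, addr0, adde0).
have [w Ew /andP[w0 wb']] := below_real (cusumW_ge0 n) wb.
have WE : cusumW b W n.+1 = maxe (w%:E + W n.+1) 0 by rewrite /= wb Ew.
have -> : potential n = ((b + M0 - w) / K0 + (b + MC) / KC)%R.
  by rewrite /potential sil wb/= Ew.
have [exy|exr] := eqVneq (excess M0 (W n.+1)) +oo.
  by rewrite exy gt0_muley ?lte_fin ?invr_gt0// addey// leey.
have [x Ex x0] : exists2 x, excess M0 (W n.+1) = x%:E & (0 <= x)%R.
  move: exr (excess_ge0 M0 (W n.+1)).
  by case: (excess M0 (W n.+1)) => [x| |]//; exists x.
rewrite Ex -EFinM -EFinD lee_fin [(K0^-1 * x)%R]mulrC addrAC -mulrDl.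
have c0 : (0 <= (b + MC) / KC)%R by rewrite divr_ge0 ?(ltW KC0)//; lra.
have d0 : (M0 / K0 <= (b + M0 - w + x) / K0)%R.
  by rewrite ler_pM2r ?invr_gt0//; lra.
(* The alarm may come in the very step where CuSum_W reaches [b]; then [c0] and [d0] suffice. *)
rewrite /potential; case: ifPn => [sil'|_]; last by lra.
case: ifPn => [Wb|].
  have [r Er /andP[r0 rb]] := below_real (cusumW_ge0 n.+1) Wb.
  rewrite addrAC lerD2r -mulrDl ler_pM2r ?invr_gt0// Er/=.
  by have := @excess_step M0 w r (W n.+1); rewrite -WE => /(_ Er); rewrite Ex lee_fin; lra.
(* At the change of stage CuSum_Lambda has already been updated with the current observation; its
   being nonnegative is enough to compare with [(b + MC) / KC]. *)
rewrite -leNgt => bW.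
have [r -> /andP[r0 rb]] := below_real (cusumS_ge0 n.+1) (silent_stageC sil' bW).
have : ((b + MC - r) / KC <= (b + MC) / KC)%R by rewrite ler_pM2r ?invr_gt0//; lra.
by rewrite /=; lra.
Qed.

End potential.

Lemma indic_bool (R : realType) (T : Type) (f : T -> bool) (x : T) :
  \1_[set y | f y] x = (f x)%:R :> R.
Proof.
by rewrite indicE (_ : (x \in _) = f x)//; apply/idP/idP => [/set_mem|/mem_set].
Qed.

(** * Measurability of the procedure at a given time *)

Section measurable_scusum.
Context (R : realType) (d : measure_display) (T : measurableType d) (b : R)
  (W L : nat -> T -> \bar R) (n : nat).
Hypotheses (mW : forall t, (1 <= t <= n)%N -> measurable_fun setT (W t))
  (mL : forall t, (1 <= t <= n)%N -> measurable_fun setT (L t)).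

Lemma measurable_cusumW t : (t <= n)%N ->
  measurable_fun setT (fun w => cusumW b (W ^~ w) t).
Proof.
elim: t => [_|t IH tn]; first exact: measurable_cst.
have mt := IH (ltnW tn).
rewrite /=; apply: measurable_fun_ifT => //; first exact: measurable_fun_lte.
by apply: measurable_maxe => //; apply: emeasurable_funD => //; exact: mW.
Qed.

Lemma measurable_cusumS t : (t <= n)%N ->
  measurable_fun setT (fun w => cusumS b (W ^~ w) (L ^~ w) t).
Proof.
elim: t => [_|t IH tn]; first exact: measurable_cst.
have mt := IH (ltnW tn); have mWt := measurable_cusumW tn.
apply: measurable_fun_ifT => //; first exact: measurable_fun_lte.
by apply: measurable_maxe => //; apply: emeasurable_funD => //; exact: mL.
Qed.

Lemma measurable_silent t : (t <= n)%N ->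
  measurable_fun setT (fun w => silent (raises_alarm b (W ^~ w) (L ^~ w)) t).
Proof.
elim: t => [_|t IH tn]; first exact: measurable_cst.
under eq_fun do rewrite silentS.
apply: measurable_and; first exact/IH/ltnW.
apply: measurable_neg; apply: measurable_and; apply: measurable_fun_lee => //.
  exact: measurable_cusumW.
exact: measurable_cusumS.
Qed.

Lemma measurable_stage0 :
  measurable_fun setT (fun w => stage0 b (W ^~ w) (L ^~ w) n).
Proof.
apply: measurable_and; first exact: measurable_silent.
by apply: measurable_fun_lte => //; exact: measurable_cusumW.
Qed.

Lemma measurable_stageC :
  measurable_fun setT (fun w => stageC b (W ^~ w) (L ^~ w) n).
Proof.
apply: measurable_and; first exact: measurable_silent.
by apply: measurable_fun_lee => //; exact: measurable_cusumW.
Qed.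

Lemma measurable_potential M0 MC K0 KC :
  measurable_fun setT (fun w => potential b M0 MC K0 KC (W ^~ w) (L ^~ w) n).
Proof.
have mWn := measurable_cusumW (leqnn n); have mSn := measurable_cusumS (leqnn n).
apply: measurable_fun_ifT => //; first exact: measurable_silent.
apply: measurable_fun_ifT => //; first exact: measurable_fun_lte.
  apply: measurable_funD => //; apply: measurable_funM => //.
  by apply: measurable_funB => //; exact: measurableT_comp.
apply: measurable_funM => //.
by apply: measurable_funB => //; exact: measurableT_comp.
Qed.

End measurable_scusum.

Lemma measurable_excess (R : realType) (d : measure_display)
    (T : measurableType d) (M : R) (f : T -> \bar R) :
  measurable_fun setT f -> measurable_fun setT (fun x => excess M (f x)).
Proof. by move=> mf; apply: measurable_maxe => //; exact: emeasurable_funB. Qed.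

(** * The delay bound for a fixed change-point *)

Section detection_delay.
Context (R : realType) (d dO : measure_display) (E : measurableType d)
  (Omega : measurableType dO).
Variables (mu : {measure set E -> \bar R}) (f0 fC fB : E -> R).
Hypotheses (hf0 : is_density mu f0) (hfC : is_density mu fC)
  (hfB : is_density mu fB).
Variables (P : probability Omega R) (X : nat -> Omega -> E) (nu : nat).
Hypotheses (nu_gt0 : (1 <= nu)%N) (lawX : change_law mu f0 fB nu P X).
Variables (b M0 MC K0 KC : R).
Hypotheses (b_gt0 : (0 < b)%R) (M0_ge0 : (0 <= M0)%R) (MC_ge0 : (0 <= MC)%R)
  (K0_gt0 : (0 < K0)%R) (KC_gt0 : (0 < KC)%R).
Hypothesis drift0 :
  \int[mu]_x (excess M0 (llr fB f0 x) * (fB x)%:E) <= (M0 - K0)%:E.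
Hypothesis driftC :
  \int[mu]_x (excess MC (llr fB fC x) * (fB x)%:E) <= (MC - KC)%:E.

Let W t w := llr fB f0 (X t w).
Let L t w := llr fB fC (X t w).
Let sil n w := silent (raises_alarm b (W ^~ w) (L ^~ w)) n.
Let V n w := potential b M0 MC K0 KC (W ^~ w) (L ^~ w) n.

Let mX t : (1 <= t)%N -> measurable_fun setT (X t).
Proof. by move=> t1; case: lawX => _ /(_ _ t1)[]. Qed.

Let mllr0 : measurable_fun setT (llr fB f0). Proof. exact: (measurable_llr hfB hf0). Qed.
Let mllrC : measurable_fun setT (llr fB fC). Proof. exact: (measurable_llr hfB hfC). Qed.

Let mW t : (1 <= t)%N -> measurable_fun setT (W t).
Proof. by move=> t1; apply: measurableT_comp => //; exact: mX. Qed.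

Let mL t : (1 <= t)%N -> measurable_fun setT (L t).
Proof. by move=> t1; apply: measurableT_comp => //; exact: mX. Qed.

Let measurable_boolset d' (T : measurableType d') (g : T -> bool) :
  measurable_fun setT g -> measurable [set w | g w].
Proof. by move=> mg; rewrite -[X in measurable X]setTI; exact: mg. Qed.

Let mWn n t : (1 <= t <= n)%N -> measurable_fun setT (W t).
Proof. by move=> /andP[t1 _]; exact: mW. Qed.

Let mLn n t : (1 <= t <= n)%N -> measurable_fun setT (L t).
Proof. by move=> /andP[t1 _]; exact: mL. Qed.

Let msil n : measurable [set w | sil n w].
Proof. exact/measurable_boolset/(measurable_silent b (@mWn n) (@mLn n)). Qed.

Let mV n : measurable_fun setT (fun w => (V n w)%:E).
Proof. exact/measurable_EFinP/(measurable_potential _ (@mWn n) (@mLn n)). Qed.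

Let V_ge0 n w : (0 <= V n w)%R.
Proof. exact: (potential_ge0 _ _ b_gt0 M0_ge0 MC_ge0 K0_gt0 KC_gt0). Qed.

(** The measurability lemmas ask for measurable scores up to time [n] only, so they also apply to
    [Omega] equipped with the history sigma-algebra. *)
Let history_stage0 n :
  <<s cylinders X n >> [set w | stage0 b (W ^~ w) (L ^~ w) n].
Proof.
apply: (@measurable_boolset _ (g_sigma_algebraType (cylinders X n))).
apply: measurable_stage0 => t tn; apply: measurableT_comp => //;
  exact: measurable_fun_cylinders.
Qed.

Let history_stageC n :
  <<s cylinders X n >> [set w | stageC b (W ^~ w) (L ^~ w) n].
Proof.
apply: (@measurable_boolset _ (g_sigma_algebraType (cylinders X n))).
apply: measurable_stageC => t tn; apply: measurableT_comp => //;
  exact: measurable_fun_cylinders.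
Qed.

(** The event [S] is determined by the first [n] observations, and [X n.+1] has density [fB] because
    [nu <= n.+1]; the expectation factorises. *)
Let stage_drift (M K : R) (g : E -> \bar R) n (S : Omega -> bool) :
  (0 <= M)%R -> (0 < K)%R ->
  measurable_fun setT g ->
  <<s cylinders X n >> [set w | S w] ->
  \int[mu]_x (excess M (g x) * (fB x)%:E) <= (M - K)%:E ->
  (nu <= n.+1)%N ->
  \int[P]_w ((K^-1)%:E * (excess M (g (X n.+1 w)) * ((S w)%:R)%:E))
    <= (M / K * fine (P [set w | S w]) - fine (P [set w | S w]))%:E.
Proof.
move=> M0' K0' mg hS drift nun.
case: (lawX) => indX lawXn.
have [mS _] := independent_history mX indX hS measurableT.
have [mfB fB0 _] := hfB.
have Xn : has_density mu P (X n.+1) fB by have := lawXn n.+1 isT; rewrite ltnNge nun.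
have mex : measurable_fun setT (fun x => excess M (g x)) by exact: measurable_excess.
have mexX : measurable_fun setT (fun w => excess M (g (X n.+1 w))).
  by apply: (measurableT_comp mex); exact: mX.
rewrite ge0_integralZl//; last 3 first.
- apply: emeasurable_funM; first exact: mexX.
  apply/measurable_EFinP; rewrite (_ : (fun w => _) = \1_[set w | S w]).
    exact: measurable_indic.
  by apply/funext => w; rewrite indic_bool.
- by move=> w _; rewrite mule_ge0 ?excess_ge0 ?lee_fin.
- by rewrite lee_fin invr_ge0 ltW.
under eq_integral do rewrite -indic_bool.
rewrite (ge0_integral_independent_history mX indX mfB fB0 Xn mex)//; last first.
  by move=> x; exact: excess_ge0.
have PS : P [set w | S w] = (fine (P [set w | S w]))%:E.
  by rewrite fineK ?fin_num_measure.
rewrite {1}PS muleA -EFinM muleC.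
apply: (@le_trans _ _ ((M - K)%:E * (K^-1 * fine (P [set w | S w]))%:E)).
  by apply: lee_wpmul2r => //; rewrite lee_fin mulr_ge0 ?invr_ge0 ?(ltW K0') ?fine_ge0.
have MK : ((M - K) / K = M / K - 1)%R by rewrite mulrBl divff ?gt_eqF.
by rewrite -EFinM lee_fin mulrA MK mulrBl mul1r.
Qed.

Let a n := \int[P]_w (V n w)%:E.

(** The factor [P [set w | sil n w]] matters: at [n = nu.-1] it is the probability of the
    conditioning event. *)
Let a_bound n : a n <= ((b + M0) / K0 + (b + MC) / KC)%:E * P [set w | sil n w].
Proof.
have c0 : (0 <= (b + M0) / K0 + (b + MC) / KC)%R.
  by rewrite addr_ge0// divr_ge0 ?addr_ge0// ltW.
rewrite -[X in P X]setIT -integral_indic// -ge0_integralZl//; last first.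
  by apply/measurable_EFinP; exact: measurable_indic.
apply: ge0_le_integral => //.
- by move=> w _; rewrite lee_fin.
- by apply: emeasurable_funM => //; apply/measurable_EFinP; exact: measurable_indic.
- move=> w _; rewrite -EFinM lee_fin indic_bool.
  exact: (potential_le _ _ b_gt0 M0_ge0 MC_ge0 K0_gt0 KC_gt0).
Qed.

Let a_fin n : a n \is a fin_num.
Proof.
rewrite ge0_fin_numE; last by apply: integral_ge0 => w _; rewrite lee_fin.
by apply: le_lt_trans (a_bound n) _; rewrite -[P _]fineK ?fin_num_measure//
  -EFinM ltry.
Qed.

(** In the mean, each stage adds [M / K] times its probability on the left of [potential_step] and
    at most [M / K - 1] times it on the right. The net drop is the probability of being in either
    stage, that is, of no alarm yet. *)
Let a_step n : (nu <= n.+1)%N -> a n.+1 + P [set w | sil n w] <= a n.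
Proof.
move=> nun.
pose S0 w := stage0 b (W ^~ w) (L ^~ w) n.
pose SC w := stageC b (W ^~ w) (L ^~ w) n.
pose p0 := fine (P [set w | S0 w]); pose pC := fine (P [set w | SC w]).
have mS0 : measurable_fun setT S0 := measurable_stage0 b (@mWn n) (@mLn n).
have mSC : measurable_fun setT SC := measurable_stageC b (@mWn n) (@mLn n).
have mbool (S : Omega -> bool) : measurable_fun setT S ->
    measurable_fun setT (fun w => (S w)%:R : R).
  move=> mS; rewrite (_ : (fun w => _) = \1_[set w | S w]).
    exact/measurable_indic/measurable_boolset.
  by apply/funext => w; rewrite indic_bool.
have int_bool (S : Omega -> bool) : measurable_fun setT S ->
    \int[P]_w ((S w)%:R)%:E = (fine (P [set w | S w]))%:E.
  move=> mS; under eq_integral do rewrite -indic_bool.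
  rewrite integral_indic ?setIT ?fineK ?fin_num_measure//;
    exact: measurable_boolset.
have mex M g : measurable_fun setT g ->
    measurable_fun setT (fun w => excess M (g (X n.+1 w)) : \bar R).
  by move=> mg; apply: (measurableT_comp (measurable_excess M mg)); exact: mX.
pose c0 w := (K0^-1)%:E * (excess M0 (W n.+1 w) * ((S0 w)%:R)%:E).
pose cC w := (KC^-1)%:E * (excess MC (L n.+1 w) * ((SC w)%:R)%:E).
have c00 w : 0 <= c0 w.
  by rewrite !mule_ge0 ?excess_ge0 ?lee_fin ?invr_ge0 ?(ltW K0_gt0).
have cC0 w : 0 <= cC w.
  by rewrite !mule_ge0 ?excess_ge0 ?lee_fin ?invr_ge0 ?(ltW KC_gt0).
have mc0 : measurable_fun setT c0.
  apply: emeasurable_funM => //; apply: emeasurable_funM; first exact: mex.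
  exact/measurable_EFinP/mbool.
have mcC : measurable_fun setT cC.
  apply: emeasurable_funM => //; apply: emeasurable_funM; first exact: mex.
  exact/measurable_EFinP/mbool.
have h0 : \int[P]_w c0 w <= (M0 / K0 * p0 - p0)%:E.
  exact: (stage_drift M0_ge0 K0_gt0 mllr0 (@history_stage0 n) drift0 nun).
have hC : \int[P]_w cC w <= (MC / KC * pC - pC)%:E.
  exact: (stage_drift MC_ge0 KC_gt0 mllrC (@history_stageC n) driftC nun).
have psil : P [set w | sil n w] = (p0 + pC)%:E.
  rewrite -[LHS]fineK ?fin_num_measure// -int_bool; last first.
    exact: (measurable_silent b (@mWn n) (@mLn n)).
  rewrite EFinD -!int_bool// -ge0_integralD//.
  - apply: eq_integral => w _; rewrite -EFinD -natrD /S0 /SC /stage0 /stageC.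
    by rewrite -/(sil n w); case: (sil n w); rewrite //= ltNge; case: (_ <= _).
  - exact/measurable_EFinP/mbool.
  - exact/measurable_EFinP/mbool.
have k0 : (0 <= M0 / K0)%R by rewrite divr_ge0// ltW.
have kC : (0 <= MC / KC)%R by rewrite divr_ge0// ltW.
have mi0 : measurable_fun setT (fun w => (M0 / K0)%:E * ((S0 w)%:R)%:E).
  by apply: emeasurable_funM => //; exact/measurable_EFinP/mbool.
have miC : measurable_fun setT (fun w => (MC / KC)%:E * ((SC w)%:R)%:E).
  by apply: emeasurable_funM => //; exact/measurable_EFinP/mbool.
have mVi : measurable_fun setT
    (fun w => (V n.+1 w)%:E + (M0 / K0)%:E * ((S0 w)%:R)%:E).
  by apply: emeasurable_funD => //; exact: mV.
have mVc : measurable_fun setT (fun w => (V n w)%:E + c0 w).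
  by apply: emeasurable_funD => //; exact: mV.
have int_scale (S : Omega -> bool) k : measurable_fun setT S -> (0 <= k)%R ->
    \int[P]_w (k%:E * ((S w)%:R)%:E) = (k * fine (P [set w | S w]))%:E.
  move=> mS k_ge0; rewrite ge0_integralZl_EFin ?int_bool//.
  exact/measurable_EFinP/mbool.
have : \int[P]_w ((V n.+1 w)%:E + (M0 / K0)%:E * ((S0 w)%:R)%:E
        + (MC / KC)%:E * ((SC w)%:R)%:E) <= \int[P]_w ((V n w)%:E + c0 w + cC w).
  apply: ge0_le_integral => //.
  - by move=> w _; rewrite -!EFinM -!EFinD lee_fin ?addr_ge0 ?mulr_ge0 ?V_ge0
      ?invr_ge0 ?(ltW K0_gt0) ?(ltW KC_gt0).
  - exact: emeasurable_funD.
  - exact: emeasurable_funD.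
  - move=> w _; rewrite -!EFinM -!EFinD.
    exact: (potential_step _ _ b_gt0 M0_ge0 MC_ge0 K0_gt0 KC_gt0).
have V0 k w : 0 <= (V k w)%:E by rewrite lee_fin.
have i00 w : 0 <= (M0 / K0)%:E * ((S0 w)%:R)%:E.
  by rewrite -EFinM lee_fin mulr_ge0.
rewrite !ge0_integralD//; last 3 first.
- by move=> w _; exact: adde_ge0.
- by move=> w _; exact: adde_ge0.
- by move=> w _; rewrite -EFinM lee_fin mulr_ge0.
rewrite !int_scale// -/(a n) -/(a n.+1) psil => ineq.
have := le_trans ineq (leeD (leeD (lexx (a n)) h0) hC).
(* As the mean potentials are finite, the common terms cancel in the reals. *)
rewrite -(fineK (a_fin n)) -(fineK (a_fin n.+1)) -!EFinD !lee_fin -/p0 -/pC; lra.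
Qed.

Let a_sum m : a (nu + m) + \sum_(0 <= k < m) P [set w | sil (nu + k) w] <= a nu.
Proof.
elim: m => [|m IH]; first by rewrite addn0 big_nil adde0.
rewrite big_nat_recr//= addeA (addeAC (a _)) addnS.
by apply: le_trans IH; apply: leeD => //; apply: a_step; exact/leqW/leq_addr.
Qed.

Lemma delay_bound :
  cond_expectation P (fun w => T_S f0 fC fB X b b w - (nu%:R)%:E)
    [set w | (nu%:R)%:E <= T_S f0 fC fB X b b w] <=
  ((b + M0) / K0 + (b + MC) / KC)%:E.
Proof.
set c := ((b + M0) / K0 + _)%R.
have c0 : (0 <= c)%R by rewrite addr_ge0// divr_ge0 ?addr_ge0// ltW.
have TE w : T_S f0 fC fB X b b w = ereal_inf [set (t%:R)%:E | t in
    [set t | (1 <= t)%N /\ raises_alarm b (W ^~ w) (L ^~ w) t]].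
  congr ereal_inf; apply/seteqP; split => x [t /= [t1]].
    by move=> h1 h2 <-; exists t => //; split => //; apply/andP.
  by move=> /andP[h1 h2] <-; exists t.
have AE : [set w | (nu%:R)%:E <= T_S f0 fC fB X b b w] = [set w | sil nu.-1 w].
  by apply/seteqP; split => w /=; rewrite TE le_first_alarm.
rewrite /cond_expectation AE; set A := [set w | sil nu.-1 w].
have mA : measurable A by exact: msil.
have msilE n : measurable_fun setT (fun w => ((sil n w)%:R)%:E : \bar R).
  apply/measurable_EFinP; rewrite (_ : (fun w => _) = \1_[set w | sil n w]).
    exact: measurable_indic.
  by apply/funext => w; rewrite indic_bool.
have int_sil n : (nu <= n)%N -> \int[P]_(w in A) ((sil n w)%:R)%:E = P [set w | sil n w].
  move=> nun; under eq_integral do rewrite -indic_bool.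
  rewrite integral_indic// setIidl// => w /=; apply: silent_le.
  by rewrite (leq_trans (leq_pred _)).
have intA : \int[P]_(w in A) (T_S f0 fC fB X b b w - (nu%:R)%:E) <= c%:E * P A.
  rewrite (eq_integral
      (fun w => \sum_(0 <= n <oo) ((sil (nu + n) w)%:R)%:E)); last first.
    by move=> w /set_mem Aw; rewrite TE first_alarm_sub.
  rewrite integral_nneseries//; last by move=> n; exact: measurable_funTS.
  (* The chain runs from the series to [a nu], then [a nu.-1], then [c * P A]. The step from [nu.-1]
     to [nu] is allowed since observation [nu] already follows [fB]. *)
  apply: le_trans (a_bound nu.-1).
  apply: (@le_trans _ _ (a nu)).
    apply: lime_le.
      apply: is_cvg_nneseries => n _ _.
      by apply: integral_ge0 => w _; rewrite lee_fin.
    apply: nearW => m; apply: le_trans (a_sum m).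
    rewrite (eq_bigr (fun k => P [set w | sil (nu + k) w])); last first.
      by move=> k _; rewrite int_sil// leq_addr.
    by apply: leeDr; apply: integral_ge0 => w _; rewrite lee_fin.
  have := @a_step nu.-1; rewrite prednK// => /(_ (leqnn _)).
  by apply: le_trans; apply: leeDl.
(* If [P A = 0], the quotient is a nonpositive integral times +oo, which is at most 0. *)
have [PA0|PA0] := eqVneq (P A) 0.
  move: intA; rewrite PA0 mule0 inve0 => intA.
  by rewrite (@le_trans _ _ 0) ?lee_fin// mule_le0_ge0// leey.
have PAE : P A = (fine (P A))%:E by rewrite fineK ?fin_num_measure.
have PAp : (0 < fine (P A))%R by rewrite -lte_fin -PAE lt0e PA0 measure_ge0.
by move: intA; rewrite PAE inver gt_eqF// => intA; rewrite lee_pdivrMr.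
Qed.

End detection_delay.

(** * Asymptotics in the threshold *)

(** Reciprocals treat finite and infinite divergences alike: [D = +oo] gives [r = 0], and
    [(r + delta)^-1] serves as a real drift below [D] in both cases. *)
Lemma pos_inve (R : realType) (D : \bar R) : 0 < D ->
  exists r : R, [/\ (0 <= r)%R, D^-1 = r%:E &
    forall delta : R, (0 < delta)%R -> ((r + delta)^-1)%:E < D].
Proof.
case: D => [D| |]// => [|_].
  rewrite lte_fin => D0; exists D^-1%R; split; first by rewrite invr_ge0 ltW.
    by rewrite inver gt_eqF.
  move=> delta delta0; rewrite lte_fin -[ltRHS]invrK ltf_pV2 ?posrE ?ltrDl//.
    by rewrite addr_gt0 ?invr_gt0.
  by rewrite invr_gt0.
by exists 0%R; split => // delta _; rewrite ltry.
Qed.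

(** The caps [M0] and [MC] are chosen from the drifts before [b] and [nu], so the overshoot cost [C]
    is uniform in both. *)
Lemma WADD_le (R : realType) (d dO : measure_display)
    (E : measurableType d) (Omega : measurableType dO)
    (mu : {measure set E -> \bar R}) (f0 fC fB : E -> R)
    (P : nat -> probability Omega R) (X : nat -> Omega -> E)
    (hf0 : is_density mu f0) (hfC : is_density mu fC) (hfB : is_density mu fB)
    (hP : forall nu : nat, (1 <= nu)%N -> change_law mu f0 fB nu (P nu) X)
    (K0 KC : R) : (0 < K0)%R -> (0 < KC)%R ->
    K0%:E < KL mu fB f0 -> KC%:E < KL mu fB fC ->
  exists C : R, forall b : R, (0 < b)%R ->
    WADD P (T_S f0 fC fB X b b) <= (b * (K0^-1 + KC^-1) + C)%:E.
Proof.
move=> K00 KC0 /(KL_truncation hfB hf0)[M0 M00 d0] /(KL_truncation hfB hfC)[MC MC0 dC].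
exists (M0 / K0 + MC / KC)%R => b b0; apply: ge_ereal_sup => _ [nu nu1 <-].
have := delay_bound hf0 hfC hfB nu1 (hP nu nu1) b0 M00 MC0 K00 KC0 d0 dC.
by rewrite !mulrDl mulrDr addrACA.
Qed.

Theorem theorem3 (R : realType) (d dO : measure_display)
    (E : measurableType d) (Omega : measurableType dO)
    (mu : {measure set E -> \bar R}) (f0 fC fB : E -> R)
    (P : nat -> probability Omega R) (X : nat -> Omega -> E)
    (hf0 : is_density mu f0) (hfC : is_density mu fC) (hfB : is_density mu fB)
    (h0C : distinct_densities mu f0 fC) (h0B : distinct_densities mu f0 fB)
    (hCB : distinct_densities mu fC fB)
    (hKL : mine (KL mu fB f0) (KL mu fB fC) < +oo)
    (hP : forall nu : nat, (1 <= nu)%N -> change_law mu f0 fB nu (P nu) X) :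
  exists e1 e2 : R -> R,
    [/\ e1 g @[g --> +oo%R] --> (0 : R)%R,
        e2 g @[g --> +oo%R] --> (0 : R)%R &
        \forall g \near +oo%R,
          WADD P (T_S f0 fC fB X (ln g) (ln g)) <=
            ((ln g)%:E / KL mu fB f0 + (ln g)%:E / KL mu fB fC) *
              (1 + e1 g)%:E /\
          ((ln g)%:E / KL mu fB f0 + (ln g)%:E / KL mu fB fC) *
              (1 + e1 g)%:E <=
            (2 * ln g)%:E / mine (KL mu fB f0) (KL mu fB fC) *
              (1 + e2 g)%:E].
Proof.
set D0 := KL mu fB f0; set DC := KL mu fB fC.
have D0_ge0 : 0 <= D0 by exact: KL_ge0.
have DC_ge0 : 0 <= DC by exact: KL_ge0.
have [Dmin0|Dmin0] := eqVneq (mine D0 DC) 0.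
  (* Both right-hand sides are +oo, since x / 0 = +oo for x > 0. *)
  exists (cst 0%R), (cst 0%R); split; [exact: cvg_cst|exact: cvg_cst|].
  near=> g; have lng : (0 < ln g)%R by apply: ln_gt0; near: g; exact: nbhs_pinfty_gt.
  rewrite /cst addr0 !mule1 Dmin0 inve0.
  rewrite [(2 * ln g)%:E * _]gt0_muley ?lte_fin ?mulr_gt0//.
  have -> : (ln g)%:E / D0 + (ln g)%:E / DC = +oo.
    have ge0 D : 0 <= D -> 0 <= (ln g)%:E / D.
      by move=> D_ge0; rewrite mule_ge0 ?inve_ge0// lee_fin ltW.
    move: Dmin0; rewrite /mine; case: ifP => _ ->.
      by rewrite inve0 gt0_muley ?lte_fin// addye// gt_eqF// (lt_le_trans _ (ge0 _ DC_ge0)).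
    by rewrite inve0 gt0_muley ?lte_fin// addey// gt_eqF// (lt_le_trans _ (ge0 _ D0_ge0)).
  by rewrite !leey.
have /andP[D0_gt0 DC_gt0] : (0 < D0) && (0 < DC).
  by rewrite -lt_min lt_def Dmin0 le_min D0_ge0.
have [r0 [r0_ge0 D0V r0P]] := pos_inve D0_gt0.
have [rC [rC_ge0 DCV rCP]] := pos_inve DC_gt0.
pose S := (r0 + rC)%R.
(* [S = 0] would make both divergences infinite, against [hKL]. *)
have S_gt0 : (0 < S)%R.
  rewrite lt_neqAle addr_ge0// andbT eq_sym paddr_eq0//; apply/negP => /andP[r00 rC00].
  move: hKL; rewrite -/D0 -/DC ltNge => /negP; apply.
  by rewrite le_min -[D0]inveK -[DC]inveK D0V DCV (eqP r00) (eqP rC00) inve0 lexx.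
pose WS g := WADD P (T_S f0 fC fB X (ln g) (ln g)).
have WS_le eps : (0 < eps)%R ->
    \forall g \near +oo%R, WS g <= (S * ln g * (1 + eps))%:E.
  (* The bound of [WADD_le] is [ln g * (S + 2 * delta) + C]. As [4 * delta = S * eps], it suffices
     that [C <= 2 * delta * ln g], which holds for large [g]. *)
  move=> eps0; pose delta := (S * eps / 4)%R.
  have delta0 : (0 < delta)%R by rewrite divr_gt0// mulr_gt0.
  have K0 : (0 < (r0 + delta)^-1)%R by rewrite invr_gt0; lra.
  have KC : (0 < (rC + delta)^-1)%R by rewrite invr_gt0; lra.
  have [C HC] := WADD_le hf0 hfC hfB hP K0 KC (r0P _ delta0) (rCP _ delta0).
  near=> g.
  have lng : (0 < ln g)%R by apply: ln_gt0; near: g; exact: nbhs_pinfty_gt.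
  apply: (le_trans (HC _ lng)); rewrite lee_fin !invrK.
  have : (C / (2 * delta) <= ln g)%R.
    rewrite -ler_expR lnK; last by rewrite posrE; near: g; exact: nbhs_pinfty_gt.
    by near: g; exact: nbhs_pinfty_ge.
  rewrite ler_pdivrMr; last by rewrite mulr_gt0.
  have -> : (S * ln g * (1 + eps) = ln g * S + ln g * (4 * delta))%R.
    by rewrite /delta; field.
  by rewrite /S; lra.
(* The relative excess of the delay over its first-order term. Its positive part is taken so that
   [1 + e g >= 0], as the second inequality requires. *)
pose e g := Num.max 0%R (fine (WS g) / (S * ln g) - 1)%R.
have e0 : e g @[g --> +oo%R] --> (0 : R)%R.
  apply/cvgrPdist_le => eps eps0; near=> g.
  have lng : (0 < ln g)%R by apply: ln_gt0; near: g; exact: nbhs_pinfty_gt.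
  have Slng : (0 < S * ln g)%R by rewrite mulr_gt0.
  rewrite sub0r normrN ger0_norm ?le_max ?lexx// /e ge_max (ltW eps0)/=.
  rewrite lerBlDl ler_pdivrMr// mulrC.
  have : WS g <= (S * ln g * (1 + eps))%:E by near: g; exact: WS_le.
  case: (WS g) => [x| |]//= _.
  by rewrite mulr_ge0// ?(ltW Slng)//; lra.
exists e, e; split => //; near=> g.
have lng : (0 < ln g)%R by apply: ln_gt0; near: g; exact: nbhs_pinfty_gt.
have Slng : (0 < S * ln g)%R by rewrite mulr_gt0.
have e_ge0 : (0 <= e g)%R by rewrite le_max lexx.
rewrite D0V DCV -!EFinM -mulrDr -/S [(ln g * S)%R]mulrC; split.
  rewrite -/(WS g).
  (* The choice [eps = 1] serves to exclude [WS g = +oo], where [fine] would return 0. *)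
  have : WS g <= (S * ln g * (1 + 1))%:E by near: g; exact: WS_le.
  rewrite /e; case: (WS g) => [x| |]//= _; last by rewrite leNye.
  by rewrite lee_fin mulrC -ler_pdivrMr// -lerBlDl le_max lexx orbT.
(* The reciprocal of the smaller divergence is the larger of [r0] and [rC], hence at least half
   their sum. *)
have [rmin DminV rminP] : exists2 r, (mine D0 DC)^-1 = r%:E & (S <= 2 * r)%R.
  rewrite /mine; case: ifPn => DD; [exists r0|exists rC] => //.
    have : rC%:E <= r0%:E :> \bar R by rewrite -D0V -DCV lee_pV2 ?inE// ltW.
    by rewrite lee_fin /S; lra.
  have : r0%:E <= rC%:E :> \bar R by rewrite -D0V -DCV lee_pV2 ?inE// leNgt.
  by rewrite lee_fin /S; lra.
rewrite DminV -!EFinM lee_fin ler_wpM2r//; first by lra.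
by nra.
Unshelve. all: end_near.
Qed.
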